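(* Fix $\lambda>0$ and $\alpha\in[0,1)$. For each $n\ge 1$ let $K_{\alpha,\lambda n,n}$ be the number of parts of a random partition of $\{1,\dots,n\}$ drawn from the Ewens--Pitman model with parameters $\alpha$ and $\theta=\lambda n$, all these random variables being defined on a common probability space. Then $$\lim_{n\to\infty}\frac{K_{\alpha,\lambda n,n}}{n}=\mathfrak{m}_{\lambda,\alpha}\quad\text{almost surely},$$ where $$\mathfrak{m}_{\lambda,\alpha}=\begin{cases}\dfrac{\lambda}{\alpha}\left[\left(1+\dfrac1\lambda\right)^{\alpha}-1\right], & \alpha\in(0,1),\\[2mm] \lambda\log\left(1+\dfrac1\lambda\right), & \alpha=0.\end{cases}$$
   Context: Ewens--Pitman model: for $\alpha\in[0,1)$ and $\theta>0$ (here $\theta=\lambda n$), a random partition of $\{1,\dots,n\}$ with $K_n$ parts of sizes $N_n=(N_1,\dots,N_{K_n})$ (parts listed in exchangeable order) has law $$P\big(K_n=k,\,N_n=(n_1,\dots,n_k)\big)=\frac1{k!}\binom{n}{n_1,\dots,n_k}\frac{[\theta]_{k,\alpha}}{[\theta]_{n,1}}\prod_{i=1}^k[1-\alpha]_{n_i-1,1},$$ for positive integers $n_1,\dots,n_k$ with sum $n$, where $[x]_{m,a}=x(x+a)\cdots(x+(m-1)a)$ (with $[x]_{0,a}=1$) is the rising factorial of order $m$ and increment $a$. Equivalently (Generalized Chinese Restaurant construction), the number of parts $K_{\alpha,\theta,n}$ has the law of the number of occupied tables after $n$ customers, where customer 1 opens a table and, given that $m-1\ge1$ customers occupy $k$ tables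 with $n_i$ customers at table $i$, customer $m$ joins table $i$ with probability $\frac{n_i-\alpha}{\theta+m-1}$ and opens a new table with probability $\frac{\theta+\alpha k}{\theta+m-1}$. For each $n$ the parameter $\theta=\lambda n$ changes with $n$; no particular joint law of the variables for different $n$ is prescribed. *)

(* Defs.v *)
From HB Require Import structures.
From mathcomp Require Import all_boot all_order all_algebra.
From mathcomp Require Import all_classical all_reals all_analysis.

Set Implicit Arguments.
Unset Strict Implicit.
Unset Printing Implicit Defensive.

Import Order.TTheory GRing.Theory Num.Theory.

Local Open Scope ring_scope.

(* [x]_{m,a} = x (x + a) ... (x + (m - 1) a) *)
Definition rising_fact (R : realType) (x a : R) (m : nat) : R :=
  \prod_(i < m) (x + a *+ i).

(* P(K_n = k, N_n = (n_1, ..., n_k)) in the Ewens--Pitman model with parameters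
   alpha and theta. The block sizes are stored as elements of 'I_n.+1 only so
   that they range over a finite type; the formula is meant for compositions
   of n, see [is_composition]. *)
Definition EP_joint (R : realType) (alpha theta : R) (n k : nat)
    (s : k.-tuple 'I_n.+1) : R :=
  (k`!%:R)^-1
  * (n`!%:R / \prod_(i < k) (tnth s i)`!%:R)
  * (rising_fact theta alpha k / rising_fact theta 1 n)
  * \prod_(i < k) rising_fact (1 - alpha) 1 (tnth s i).-1.

Definition is_composition (n k : nat) (s : k.-tuple 'I_n.+1) : bool :=
  [forall i : 'I_k, (0 < tnth s i)%N] && (\sum_(i < k) tnth s i == n)%N.

(* Law of the number of parts K_n: the first marginal of the joint law of
   (K_n, N_n). *)
Definition EP_nparts (R : realType) (alpha theta : R) (n k : nat) : R :=
  \sum_(s : k.-tuple 'I_n.+1 | is_composition s) EP_joint alpha theta s.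

Definition EP_limit (R : realType) (lambda alpha : R) : R :=
  if alpha == 0 then lambda * ln (1 + lambda^-1)
  else lambda / alpha * ((1 + lambda^-1) `^ alpha - 1).

(* Main.v *)
Require Import Defs.
From HB Require Import structures.
From mathcomp Require Import all_boot all_order all_algebra.
From mathcomp Require Import all_classical all_reals all_analysis.
From mathcomp Require Import measurable_realfun.
From mathcomp Require Import ring lra.
Set Implicit Arguments.
Unset Strict Implicit.
Unset Printing Implicit Defensive.
Import Order.TTheory GRing.Theory Num.Theory.
Import numFieldNormedType.Exports.
Local Open Scope classical_set_scope.
Local Open Scope ring_scope.

(** The joint law of the variables K_n is arbitrary, so almost sure convergence
    has to come from a deviation bound that is summable in n and that depends
    only on the marginal laws.

    Fix theta.  The law of the number of parts satisfies the Chinese restaurant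
    recursion ([EP_npartsSS]): passing from m to m + 1 elements, a configuration
    with k parts gets a new part with probability
    q = (theta + alpha k) / (theta + m).  The recursion is read off the
    exponential generating function F of the block weights [1 - alpha]_{j-1}:
    up to explicit factors the law is the coefficient of X^n in F^k, and F
    satisfies (1 - X) F' = 1 - alpha F.

    Consequently ([EP_meanS]) the number of parts evolves like a chain with
    Bernoulli increments.  Let e_m be its mean and D_m the centered number of
    parts.  Since q is affine in k,
       D_{m+1} = (1 + alpha / (theta + m)) D_m + xi,
    where xi is a centered Bernoulli variable given the past, so |xi| <= 1.
    Expanding the square and the fourth power gives, with r = 1 + 1 / theta,
       E D_m^2 <= m r^{2m}   and   E D_m^4 <= 4 m^2 r^{4m}
    ([EP_second_moment], [EP_fourth_moment]).  For theta = lambda n and m = n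
    the power r^{4n} is at most exp (4 / lambda) ([growth_bound]), hence
    E (D_n / n)^4 = O(1 / n^2).  The series of these expectations converges, so
    the series of the (D_n / n)^4 converges almost surely, and its terms tend
    to 0 ([ae_cvg0_summable_integral]).

    It remains to show that e_n / n tends to the announced limit
    ([mean_nparts_cvg]).  Solving the affine recursion gives
    e_n = sum_{i<n} theta / (theta + i) for alpha = 0, and
    e_n = theta / alpha (prod_{i<n} (1 + alpha / (theta + i)) - 1) otherwise;
    both reduce to the fact that sum_{i<n} 1 / (lambda n + i) tends to
    ln (1 + 1 / lambda) ([harmonic_window_cvg]). *)

(** * Generating function of the block weights *)

(** Coefficients of the exponential generating function
    (1 - (1 - x) ^ alpha) / alpha; the zero constant term excludes empty
    blocks. *)
Definition block_weight (R : realType) (alpha : R) (m : nat) : R :=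
  if m is j.+1 then rising_fact (1 - alpha) 1 j / m`!%:R else 0.

Definition block_poly (R : realType) (alpha : R) (N : nat) : {poly R} :=
  \poly_(i < N.+1) block_weight alpha i.

Lemma rising_factS (R : realType) (x a : R) m :
  rising_fact x a m.+1 = rising_fact x a m * (x + a *+ m).
Proof. by rewrite /rising_fact big_ord_recr. Qed.

Lemma rising_fact_gt0 (R : realType) (x a : R) m :
  0 < x -> 0 <= a -> 0 < rising_fact x a m.
Proof. by move=> x0 a0; apply: prodr_gt0 => i _; rewrite ltr_wpDr ?mulrn_wge0. Qed.

Lemma natf_fact_neq0 (R : realType) m : (m`!%:R : R) != 0.
Proof. by rewrite pnatr_eq0 -lt0n fact_gt0. Qed.

(** Coefficient form of (1 - x) F' = 1 - alpha F. *)
Lemma block_weight_rec (R : realType) (alpha : R) m :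
  block_weight alpha m.+1 *+ m.+1 =
  block_weight alpha m *+ m + (m == 0)%:R - alpha * block_weight alpha m.
Proof.
rewrite -[LHS]mulr_natr -(mulr_natr _ m).
case: m => [|j]; first by rewrite /block_weight /rising_fact big_ord0 -[1`!]/1%N eqxx /= invr1 !mulr0 subr0 add0r !mulr1.
rewrite /block_weight rising_factS (factS j.+1) natrM /= addr0.
have h1 := natf_fact_neq0 R j.+1.
have h2 : (j.+2%:R : R) != 0 by rewrite pnatr_eq0.
rewrite -[1 *+ j]/(j%:R) -!natr1 in h2 *.
by field; rewrite h1 h2.
Qed.

Lemma coefM_eq (R : comNzRingType) (p q r : {poly R}) n :
  (forall i, (i <= n)%N -> p`_i = q`_i) -> (p * r)`_n = (q * r)`_n.
Proof.
move=> h; rewrite !coefM; apply: eq_bigr => i _.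
by rewrite h // -ltnS.
Qed.

(** This is what makes truncation harmless: a coefficient of a power depends only on
    the coefficients of the base up to the same index. *)
Lemma coefX_eq (R : comNzRingType) (p q : {poly R}) n k :
  (forall i, (i <= n)%N -> p`_i = q`_i) ->
  forall i, (i <= n)%N -> (p ^+ k)`_i = (q ^+ k)`_i.
Proof.
move=> h; elim: k => [|k IH] i le_in; first by rewrite !expr0.
rewrite !exprS (@coefM_eq _ p q); last by move=> j ji; apply/h/(leq_trans ji).
rewrite ![q * _]mulrC; apply: coefM_eq => j ji; apply: IH.
exact: leq_trans ji le_in.
Qed.

(** The truncated generating function satisfies the differential equation only
    up to its truncation order, whence the bound on [i]. *)
Lemma block_poly_ode (R : realType) (alpha : R) n i : (i <= n)%N ->
  ((1 - 'X) * (block_poly alpha n.+1)^`())`_i =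
  (1 - alpha *: block_poly alpha n.+1)`_i.
Proof.
move=> le_in.
rewrite mulrBl mul1r coefB coefXM !coefB coef1 coefZ !coef_deriv !coef_poly.
rewrite !ltnS le_in leqW // block_weight_rec.
case: i le_in => [|i] le_in /=; first by rewrite /block_weight; ring.
by rewrite ltnW //; ring.
Qed.

(** The generalized factorial coefficient C(n, k; alpha), divided by alpha ^ k so
    that it also makes sense for alpha = 0, where it is an unsigned Stirling number
    of the first kind. *)
Definition gen_fact_coef (R : realType) (alpha : R) (n k : nat) : R :=
  n`!%:R / k`!%:R * (block_poly alpha n ^+ k)`_n.

(** Any truncation order above [n] gives the same coefficient, so that
    the coefficients for [n] and [n.+1] can be computed in a common polynomial. *)
Lemma gen_fact_coef_trunc (R : realType) (alpha : R) n N k : (n <= N)%N ->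
  gen_fact_coef alpha n k = n`!%:R / k`!%:R * (block_poly alpha N ^+ k)`_n.
Proof.
move=> nN; congr (_ * _); apply: (@coefX_eq _ _ _ n) => // i le_in.
by rewrite !coef_poly !ltnS le_in (leq_trans le_in nN).
Qed.

(** Compare the coefficients of X^n in
    (1 - X) (F^(k+1))' = (k + 1) (F^k - alpha F^(k+1)),
    which follows from the differential equation of F. *)
Lemma gen_fact_coefSS (R : realType) (alpha : R) n k :
  gen_fact_coef alpha n.+1 k.+1 =
  (n%:R - alpha * k.+1%:R) * gen_fact_coef alpha n k.+1 + gen_fact_coef alpha n k.
Proof.
rewrite !(@gen_fact_coef_trunc _ _ _ n.+1) //; set F := block_poly alpha n.+1.
have key : ((1 - 'X) * (F ^+ k.+1)^`())`_n =
   ((F ^+ k)`_n - alpha * (F ^+ k.+1)`_n) *+ k.+1.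
  rewrite deriv_exp /= mulrnAr coefMn mulrA.
  rewrite (coefM_eq _ (@block_poly_ode R alpha n)).
  by rewrite -/F mulrBl mul1r coefB -scalerAl coefZ -exprS.
move: key; rewrite mulrBl mul1r coefB coefXM coef_deriv.
have -> : (if n == 0%N then 0 else (F ^+ k.+1)^`()`_n.-1) = (F ^+ k.+1)`_n *+ n.
  by case: n @F => [|n] F //=; rewrite coef_deriv.
rewrite !factS !natrM.
have h1 := natf_fact_neq0 R k.
have h2 : (k.+1%:R : R) != 0 by rewrite pnatr_eq0.
set a := (F ^+ k.+1)`_n.+1; set b := (F ^+ k.+1)`_n; set c := (F ^+ k)`_n.
move=> key.
have {}key : a * n.+1%:R = b * n%:R + (c - alpha * b) * k.+1%:R by move: key; rewrite -!(mulr_natr a) -!(mulr_natr b) -!(mulr_natr (c - _)) => <-; ring.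
have -> : n.+1%:R * n`!%:R / (k.+1%:R * k`!%:R) * a =
  n`!%:R / (k.+1%:R * k`!%:R) * (a * n.+1%:R) by ring.
rewrite key; move: (k.+1%:R) h2 => K h2.
by field; rewrite h1 h2.
Qed.

Lemma gen_fact_coef0 (R : realType) (alpha : R) n :
  gen_fact_coef alpha n 0 = (n == 0)%:R.
Proof.
rewrite /gen_fact_coef expr0 coef1; case: eqP => [->|_]; last by rewrite mulr0.
by rewrite fact0 divr1 mulr1.
Qed.

(** Expanding F^k over all k-tuples of exponents, the coefficient of X^n collects the
    tuples with sum n; those with an empty block have weight 0. *)
Lemma EP_npartsE (R : realType) (alpha theta : R) n k :
  EP_nparts alpha theta n k =
  rising_fact theta alpha k / rising_fact theta 1 n * gen_fact_coef alpha n k.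
Proof.
rewrite /EP_nparts /gen_fact_coef /EP_joint.
have -> : (block_poly alpha n ^+ k)`_n =
   \sum_(s : k.-tuple 'I_n.+1 | is_composition s)
      \prod_(i < k) block_weight alpha (tnth s i).
  have -> : block_poly alpha n ^+ k =
     \sum_(f : {ffun 'I_k -> 'I_n.+1})
        (\prod_i block_weight alpha (f i)) *: 'X^(\sum_i f i).
    rewrite -[k in _ ^+ k]card_ord -prodr_const.
    under eq_bigr do rewrite /block_poly poly_def.
    rewrite bigA_distr_bigA /=; apply: eq_bigr => f _.
    by rewrite scaler_prod -expr_sum.
  rewrite coef_sum.
  rewrite (reindex (fun s : k.-tuple 'I_n.+1 => [ffun i => tnth s i])) /=; last first.
    exists (fun f : {ffun 'I_k -> 'I_n.+1} => [tuple f i | i < k]) => x _.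
      by apply: eq_from_tnth => i; rewrite tnth_mktuple ffunE.
    by apply/ffunP => i; rewrite ffunE tnth_mktuple.
  rewrite [RHS]big_mkcond /=; apply: eq_bigr => s _.
  rewrite coefZ coefXn /is_composition.
  rewrite (eq_bigr (fun i => nat_of_ord (tnth s i))); last by move=> i _; rewrite ffunE.
  rewrite [X in X * _](eq_bigr (fun i => block_weight alpha (tnth s i))); last by move=> i _; rewrite ffunE.
  rewrite [(n == _)]eq_sym.
  case: (boolP [forall i, _]) => [_|] /=; first by case: eqP; rewrite ?(mulr1, mulr0).
  rewrite negb_forall => /existsP[i]; rewrite -eqn0Ngt => /eqP i0.
  by rewrite (bigD1 i) //= i0 !mul0r.
rewrite !mulr_sumr; apply: eq_bigr => s /andP[/forallP s_gt0 _].
have -> : \prod_(i < k) block_weight alpha (tnth s i) =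
   (\prod_(i < k) rising_fact (1 - alpha) 1 (tnth s i).-1) / \prod_(i < k) (tnth s i)`!%:R.
  rewrite -prodf_div; apply: eq_bigr => i _.
  by have := s_gt0 i; case: (nat_of_ord (tnth s i)).
ring.
Qed.

(** * The Chinese restaurant recursion *)

(** The conditional probability that the customer arriving after m others, seated
    at k tables, opens a new table. *)
Definition new_table (R : realType) (alpha theta : R) (m k : nat) : R :=
  (theta + alpha * k%:R) / (theta + m%:R).

Lemma EP_npartsSS (R : realType) (alpha theta : R) m k : 0 < theta -> 
  EP_nparts alpha theta m.+1 k.+1 =
  (1 - new_table alpha theta m k.+1) * EP_nparts alpha theta m k.+1
  + new_table alpha theta m k * EP_nparts alpha theta m k.
Proof.
move=> t0; rewrite !EP_npartsE gen_fact_coefSS !rising_factS /new_table.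
have h1 : rising_fact theta 1 m != 0 by rewrite gt_eqF ?rising_fact_gt0.
have h2 : theta + m%:R != 0 by rewrite gt_eqF // ltr_wpDr.
rewrite -(mulr_natr alpha).
by field; rewrite h1 h2.
Qed.

Lemma EP_npartsS0 (R : realType) (alpha theta : R) m : 0 < theta -> 
  EP_nparts alpha theta m.+1 0 =
  (1 - new_table alpha theta m 0) * EP_nparts alpha theta m 0.
Proof.
move=> t0; rewrite !EP_npartsE !gen_fact_coef0 mulr0.
case: m => [|m]; last by rewrite !mulr0.
rewrite /new_table mulr0n mulr0 !addr0. by rewrite divff ?lt0r_neq0 // subrr mul0r.
Qed.

Lemma EP_nparts_ge0 (R : realType) (alpha theta : R) m k :
  0 <= alpha -> alpha < 1 -> 0 < theta -> 0 <= EP_nparts alpha theta m k.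
Proof.
move=> a0 a1 t0; apply: sumr_ge0 => s _; rewrite /EP_joint.
have rf_ge0 x a j : 0 < x -> 0 <= a -> 0 <= rising_fact x a j :> R.
  by move=> x0 ?; rewrite ltW ?rising_fact_gt0.
rewrite !mulr_ge0 ?divr_ge0 ?invr_ge0 ?rf_ge0 ?prodr_ge0 // => i _.
by rewrite rf_ge0 ?subr_gt0.
Qed.

Lemma EP_nparts_gt (R : realType) (alpha theta : R) m k :
  (m < k)%N -> EP_nparts alpha theta m k = 0.
Proof.
move=> mk; rewrite /EP_nparts big_pred0 // => s.
apply/negP => /andP[/forallP s_gt0 /eqP sm]; move: mk; rewrite ltnNge -{1}sm.
by rewrite -[k in (k <= _)%N]card_ord -sum1_card leq_sum.
Qed.

(** Expectation of [f] of the number of parts: the sum is finite because there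
    are at most [m] parts. *)
Definition EP_mean (R : realType) (alpha theta : R) (m : nat) (f : nat -> R) : R :=
  \sum_(k < m.+1) f k * EP_nparts alpha theta m k.

Lemma EP_mean0 (R : realType) (alpha theta : R) f :
  EP_mean alpha theta 0 f = f 0%N.
Proof.
rewrite /EP_mean big_ord1 EP_npartsE gen_fact_coef0 /rising_fact !big_ord0.
by rewrite divr1 !mulr1.
Qed.

(** This turns the recursion on the laws into a recursion on expectations, which
    stands in for conditioning on the previous state of the chain. *)
Lemma EP_meanS (R : realType) (alpha theta : R) m f : 0 < theta ->
  EP_mean alpha theta m.+1 f =
  EP_mean alpha theta m (fun k => (1 - new_table alpha theta m k) * f k
    + new_table alpha theta m k * f k.+1).
Proof.
move=> t0; rewrite /EP_mean big_ord_recl /= EP_npartsS0 //.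
under eq_bigr do rewrite EP_npartsSS // mulrDr.
rewrite big_split /= addrA.
under [RHS]eq_bigr do rewrite mulrDl.
rewrite [RHS]big_split /=; congr (_ + _); last first.
  by apply: eq_bigr => k _; rewrite /bump /=; ring.
rewrite [in LHS]big_ord_recr /= [in RHS]big_ord_recl /= /bump /= !add1n.
rewrite (EP_nparts_gt _ _ (ltnSn m)) !mulr0 addr0.
congr (_ + _); first by ring.
by apply: eq_bigr => k _; rewrite add1n; ring.
Qed.

(** * Moments of the number of parts *)

Lemma new_table_ge0 (R : realType) (alpha theta : R) m k :
  0 <= alpha -> 0 < theta -> 0 <= new_table alpha theta m k.
Proof.
by move=> a0 t0; rewrite divr_ge0 ?addr_ge0 ?mulr_ge0 ?ler0n // ltW.
Qed.

Lemma new_table_le1 (R : realType) (alpha theta : R) m k :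
  alpha <= 1 -> 0 < theta -> (k <= m)%N -> new_table alpha theta m k <= 1.
Proof.
move=> a1 t0 km; rewrite /new_table ler_pdivrMr ?ltr_wpDr // mul1r lerD2l.
apply: le_trans (_ : k%:R <= _); last by rewrite ler_nat.
by rewrite ler_piMl.
Qed.

Lemma le_EP_mean (R : realType) (alpha theta : R) m (f g : nat -> R) :
  0 <= alpha -> alpha < 1 -> 0 < theta ->
  (forall k, (k <= m)%N -> f k <= g k) ->
  EP_mean alpha theta m f <= EP_mean alpha theta m g.
Proof.
move=> a0 a1 t0 fg; apply: ler_sum => k _.
by rewrite ler_wpM2r ?EP_nparts_ge0 // fg // -ltnS.
Qed.

Lemma EP_meanD (R : realType) (alpha theta : R) m (f g : nat -> R) :
  EP_mean alpha theta m (fun k => f k + g k) =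
  EP_mean alpha theta m f + EP_mean alpha theta m g.
Proof. by rewrite -big_split; apply: eq_bigr => k _; rewrite mulrDl. Qed.

Lemma EP_meanZ (R : realType) (alpha theta : R) m (c : R) (f : nat -> R) :
  EP_mean alpha theta m (fun k => c * f k) = c * EP_mean alpha theta m f.
Proof. by rewrite mulr_sumr; apply: eq_bigr => k _; rewrite mulrA. Qed.

Lemma EP_mean_cst (R : realType) (alpha theta : R) m (c : R) :
  0 < theta -> EP_mean alpha theta m (fun=> c) = c.
Proof.
move=> t0; elim: m => [|m IH]; first exact: EP_mean0.
rewrite EP_meanS // -[RHS]IH; congr EP_mean.
by apply/funext => k; ring.
Qed.

(** The recursion of the expected number of parts: the probability of a new table is
    affine in the number of tables, so it may be evaluated at the mean. *)
Fixpoint mean_nparts (R : realType) (alpha theta : R) (m : nat) : R :=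
  if m is j.+1 then
    mean_nparts alpha theta j + (theta + alpha * mean_nparts alpha theta j) / (theta + j%:R)
  else 0.

Lemma centered_step (R : realType) (alpha theta : R) m k : 0 < theta ->
  k%:R - mean_nparts alpha theta m.+1 =
  (1 + alpha / (theta + m%:R)) * (k%:R - mean_nparts alpha theta m)
  - new_table alpha theta m k.
Proof.
move=> t0; rewrite /new_table /=; have h : theta + m%:R != 0 by rewrite gt_eqF // ltr_wpDr.
by field.
Qed.

(** The left-hand side is the second moment of x plus a centered Bernoulli
    variable, that is x ^ 2 + q (1 - q). *)
Lemma bernoulli_second (R : realType) (x q : R) : 0 <= q <= 1 ->
  (1 - q) * (x - q) ^+ 2 + q * (x - q + 1) ^+ 2 <= x ^+ 2 + 1.
Proof. by nra. Qed.

(** The cubic terms in x cancel because the Bernoulli variable is centered; the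
    remaining linear term is absorbed by 2 x w <= x ^ 2 + w ^ 2. *)
Lemma bernoulli_fourth (R : realType) (x q : R) : 0 <= q <= 1 ->
  (1 - q) * (x - q) ^+ 4 + q * (x - q + 1) ^+ 4 <= x ^+ 4 + 8 * x ^+ 2 + 4.
Proof.
move=> q01; pose v := q * (1 - q); pose w := 1 - 2 * q.
have v01 : 0 <= v <= 1 by rewrite /v; nra.
have w01 : w ^+ 2 <= 1 by rewrite /w; nra.
have xw : 2 * (x * w) <= x ^+ 2 + 1.
  by have := sqr_ge0 (x - w); rewrite sqrrB; nra.
have -> : (1 - q) * (x - q) ^+ 4 + q * (x - q + 1) ^+ 4 =
  x ^+ 4 + v * (6 * x ^+ 2 + 2 * (2 * (x * w)) + 1 - 3 * v) by rewrite /v /w; ring.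
rewrite -(addrA (x ^+ 4)) lerD2l.
apply: le_trans (_ : v * (8 * x ^+ 2 + 4) <= _).
  by rewrite ler_wpM2l; lra.
by rewrite ler_piMl; have := sqr_ge0 x; lra.
Qed.

Section moments.
Variables (R : realType) (alpha theta : R).
Hypotheses (a0 : 0 <= alpha) (a1 : alpha < 1) (t0 : 0 < theta).

Let r := 1 + theta^-1.
Let D m k := k%:R - mean_nparts alpha theta m.
Let g m := 1 + alpha / (theta + m%:R).

Let tm_gt0 m : 0 < theta + m%:R. Proof. by rewrite ltr_wpDr. Qed.

Let g_ge0 m : 0 <= g m.
Proof. by rewrite addr_ge0 // divr_ge0 // ltW. Qed.

Let g_le m : g m <= r.
Proof.
rewrite lerD2l ler_pdivrMr // mulrDr mulVf ?lt0r_neq0 //.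
by rewrite (le_trans (ltW a1)) // lerDl mulr_ge0 ?invr_ge0 ?(ltW t0) ?ler0n.
Qed.

Let r_ge1 : 1 <= r.
Proof. by rewrite lerDl invr_ge0 ltW. Qed.

Let r_ge0 : 0 <= r. Proof. exact: le_trans r_ge1. Qed.

Let DS m k : D m.+1 k = g m * D m k - new_table alpha theta m k.
Proof. exact: centered_step. Qed.

Let DSS m k : D m.+1 k.+1 = g m * D m k - new_table alpha theta m k + 1.
Proof. by rewrite -DS /D -natr1; ring. Qed.

Let q01 m k : (k <= m)%N -> 0 <= new_table alpha theta m k <= 1.
Proof. by move=> km; rewrite new_table_ge0 ?new_table_le1 // ltW. Qed.

Lemma EP_second_moment m :
  EP_mean alpha theta m (fun k => D m k ^+ 2) <= m%:R * r ^+ (2 * m).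
Proof.
elim: m => [|m IH]; first by rewrite EP_mean0 /D subrr expr0n mul0r.
rewrite EP_meanS //.
apply: (@le_trans _ _ (EP_mean alpha theta m (fun k => g m ^+ 2 * D m k ^+ 2 + 1))).
  apply: le_EP_mean => // k km.
  by rewrite DS DSS -exprMn bernoulli_second ?q01.
rewrite EP_meanD EP_meanZ EP_mean_cst // -natr1 mulrDl mul1r.
rewrite lerD ?exprn_ege1 // mulnS exprD mulrCA.
apply: ler_pM => //; rewrite ?exprn_ge0 //; last by rewrite lerXn2r ?nnegrE.
by apply: sumr_ge0 => k _; rewrite mulr_ge0 ?sqr_ge0 ?EP_nparts_ge0.
Qed.

(** One step of the chain adds at most 8 m + 4 (up to the power of r), and 4 is the
    smallest C such that C m ^ 2 + 8 m + 4 <= C (m + 1) ^ 2 for all m. *)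
Lemma EP_fourth_moment m :
  EP_mean alpha theta m (fun k => D m k ^+ 4) <= 4 * m%:R ^+ 2 * r ^+ (4 * m).
Proof.
elim: m => [|m IH]; first by rewrite EP_mean0 /D subrr !expr0n /= mulr0 mul0r.
rewrite EP_meanS //.
apply: (@le_trans _ _ (EP_mean alpha theta m
    (fun k => g m ^+ 4 * D m k ^+ 4 + 8 * g m ^+ 2 * D m k ^+ 2 + 4))).
  apply: le_EP_mean => // k km.
  by rewrite DS DSS -mulrA -!exprMn bernoulli_fourth ?q01.
rewrite !EP_meanD !EP_meanZ EP_mean_cst //.
have gX i : g m ^+ i <= r ^+ i by rewrite lerXn2r ?nnegrE.
have m0 i : (0 : R) <= EP_mean alpha theta m (fun k => D m k ^+ (2 * i)).
  by apply: sumr_ge0 => k _; rewrite mulr_ge0 ?EP_nparts_ge0 // exprM exprn_ge0 ?sqr_ge0.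
have h4 : g m ^+ 4 * EP_mean alpha theta m (fun k => D m k ^+ 4) <=
   r ^+ (4 * m.+1) * (4 * m%:R ^+ 2).
  rewrite mulnS exprD -mulrA [r ^+ (4 * m) * _]mulrC.
  by apply: ler_pM => //; [exact: exprn_ge0|exact: (m0 2%N)].
have h2 : g m ^+ 2 * EP_mean alpha theta m (fun k => D m k ^+ 2) <=
   r ^+ (4 * m.+1) * m%:R.
  apply: (@le_trans _ _ (r ^+ 2 * (m%:R * r ^+ (2 * m)))).
    by apply: ler_pM => //; [exact: exprn_ge0|exact: (m0 1%N)|exact: EP_second_moment].
  rewrite mulrCA -exprD mulrC ler_wpM2r // ler_weXn2l //.
  by rewrite -mulnS leq_mul2r orbT.
have h0 : 1 <= r ^+ (4 * m.+1) by exact: exprn_ege1.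
move: h4 h2 h0; set X := r ^+ _; set A := EP_mean _ _ _ _; set B := EP_mean _ _ _ _.
by rewrite -natr1 => *; nra.
Qed.

End moments.

(** * Asymptotics of the expected number of parts *)

(** Apply ln (1 + y) <= y to 1 + y = 1 / (1 + x). *)
Lemma ln1D_ge (R : realType) (x : R) : 0 <= x -> x / (1 + x) <= ln (1 + x).
Proof.
move=> x0; have x1 : 0 < 1 + x by rewrite ltr_pwDl.
have h : ln (1 + - (x / (1 + x))) <= - (x / (1 + x)).
  by apply: le_ln1Dx; rewrite ltrN2 ltr_pdivrMr // mul1r ltrDr.
rewrite -lerN2; apply: le_trans h.
rewrite -lnV ?posrE // le_eqVlt; apply/orP; left; apply/eqP; congr ln.
by field; rewrite gt_eqF.
Qed.

Lemma ln_gap (R : realType) (a : R) : 0 < a ->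
  (a + 1)^-1 <= ln (a + 1) - ln a <= a^-1.
Proof.
move=> a0; have a1 : 0 < a + 1 by rewrite ltr_wpDr.
rewrite -ln_div ?posrE //.
have -> : (a + 1) / a = 1 + a^-1 by rewrite mulrDl divff ?gt_eqF // mul1r.
have ai : 0 < a^-1 by rewrite invr_gt0.
rewrite le_ln1Dx ?andbT; last by rewrite (lt_trans _ ai) // ltrN10.
rewrite (le_trans _ (ln1D_ge (ltW ai))) // le_eqVlt; apply/orP; left; apply/eqP.
by field; rewrite !gt_eqF.
Qed.

Section harmonic_window.
Variables (R : realType) (theta : R).
Hypothesis t0 : 0 < theta.

Let tm_gt0 m : 0 < theta + m%:R. Proof. by rewrite ltr_wpDr. Qed.

Lemma harmonic_window_ge m :
  ln (theta + m%:R) - ln theta <= \sum_(i < m) (theta + i%:R)^-1.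
Proof.
elim: m => [|m IH]; first by rewrite big_ord0 addr0 subrr.
rewrite big_ord_recr /= -natr1 (addrA theta).
by have /andP[_] := ln_gap (tm_gt0 m); lra.
Qed.

Lemma harmonic_window_le m :
  \sum_(i < m) (theta + i%:R)^-1 <=
  ln (theta + m%:R) - ln theta + (theta^-1 - (theta + m%:R)^-1).
Proof.
elim: m => [|m IH]; first by rewrite big_ord0 addr0 !subrr addr0.
rewrite big_ord_recr /= -natr1 (addrA theta).
have /andP[+ _] := ln_gap (tm_gt0 m). lra.
Qed.
End harmonic_window.

Lemma cvg_natrV (R : realType) : (n%:R^-1 : R) @[n --> \oo] --> 0.
Proof. by rewrite -cvg_shiftS; exact: cvg_harmonic. Qed.

(** Up to the telescoping error 1 / (lambda n), the sum is
    ln (lambda n + n) - ln (lambda n), which does not depend on n. *)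
Lemma harmonic_window_cvg (R : realType) (lambda : R) : 0 < lambda ->
  \sum_(i < n) (lambda * n%:R + i%:R)^-1 @[n --> \oo] --> ln (1 + lambda^-1).
Proof.
move=> l0.
apply: (@squeeze_cvgr _ _ _ _ (fun=> ln (1 + lambda^-1)) 
  (fun n => ln (1 + lambda^-1) + lambda^-1 * n%:R^-1)); last first.
- rewrite -[X in _ --> X]addr0; apply: cvgD; first exact: cvg_cst.
  by rewrite -[0](mulr0 lambda^-1); apply: cvgM; [exact: cvg_cst|exact: cvg_natrV].
- exact: cvg_cst.
near=> n.
have n0 : 0 < n%:R :> R by rewrite ltr0n; near: n; exact: nbhs_infty_gt.
have t0 : 0 < lambda * n%:R by rewrite mulr_gt0.
have <- : ln (lambda * n%:R + n%:R) - ln (lambda * n%:R) = ln (1 + lambda^-1).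
  rewrite -ln_div ?posrE ?addr_gt0 //; congr ln.
  by field; rewrite !gt_eqF.
rewrite harmonic_window_ge //=; apply: le_trans (harmonic_window_le t0 n) _.
by rewrite lerD2l -invfM lerBlDr lerDl invr_ge0 addr_ge0 ?ltW.
Unshelve. all: by end_near. Qed.

Lemma mean_nparts_alpha0 (R : realType) (theta : R) m :
  mean_nparts 0 theta m = theta * \sum_(i < m) (theta + i%:R)^-1.
Proof.
elim: m => [|m IH] /=; first by rewrite big_ord0 mulr0.
by rewrite big_ord_recr /= mulrDr -IH mul0r addr0.
Qed.

(** The quantity e_m + theta / alpha is multiplied by 1 + alpha / (theta + m) at each
    step; the product is written as an exponential in view of its limit. *)
Lemma mean_nparts_expR (R : realType) (alpha theta : R) m :
  0 < alpha -> 0 < theta ->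
  mean_nparts alpha theta m =
  theta / alpha * (expR (\sum_(i < m) ln (1 + alpha / (theta + i%:R))) - 1).
Proof.
move=> a0 t0; elim: m => [|m IH] /=; first by rewrite big_ord0 expR0 subrr mulr0.
have tm : 0 < theta + m%:R by rewrite ltr_wpDr.
rewrite big_ord_recr /= expRD lnK ?posrE ?addr_gt0 ?divr_gt0 // IH.
set E := expR _; field; rewrite !gt_eqF //.
Qed.

(** Each ln (1 + x) lies between x - x ^ 2 and x, and the n quadratic errors
    are at most 1 / (lambda n) ^ 2 each. *)
Lemma log_product_cvg (R : realType) (alpha lambda : R) :
  0 < alpha -> alpha < 1 -> 0 < lambda ->
  \sum_(i < n) ln (1 + alpha / (lambda * n%:R + i%:R)) @[n --> \oo]
   --> alpha * ln (1 + lambda^-1).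
Proof.
move=> a0 a1 l0.
apply: (@squeeze_cvgr _ _ _ _ 
  (fun n => alpha * (\sum_(i < n) (lambda * n%:R + i%:R)^-1) - lambda^-1 ^+ 2 * n%:R^-1)
  (fun n => alpha * (\sum_(i < n) (lambda * n%:R + i%:R)^-1))); last first.
- by apply: cvgM; [exact: cvg_cst|exact: harmonic_window_cvg].
- rewrite -[X in _ --> X]subr0; apply: cvgB.
    by apply: cvgM; [exact: cvg_cst|exact: harmonic_window_cvg].
  by rewrite -[0](mulr0 (lambda^-1 ^+ 2)); apply: cvgM; [exact: cvg_cst|exact: cvg_natrV].
near=> n.
have n0 : 0 < n%:R :> R by rewrite ltr0n; near: n; exact: nbhs_infty_gt.
have ti i : 0 < lambda * n%:R + i%:R by rewrite ltr_wpDr ?mulr_gt0.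
apply/andP; split; last first.
  rewrite mulr_sumr; apply: ler_sum => i _; apply: le_ln1Dx.
  by rewrite (lt_trans (ltrN10 _)) ?divr_gt0.
have -> : lambda^-1 ^+ 2 * n%:R^-1 = \sum_(i < n) (lambda * n%:R)^-1 ^+ 2.
  by rewrite sumr_const card_ord -mulr_natr; field; rewrite !gt_eqF.
rewrite mulr_sumr -sumrB; apply: ler_sum => i _.
have x0 : 0 <= alpha / (lambda * n%:R + i%:R) by rewrite divr_ge0 ?ltW.
apply: le_trans (ln1D_ge x0).
have xle : alpha / (lambda * n%:R + i%:R) <= (lambda * n%:R)^-1.
  rewrite ler_pdivrMr // mulrDr mulVf ?mulf_neq0 ?gt_eqF //.
  by rewrite (le_trans (ltW a1)) // lerDl mulr_ge0 ?ler0n ?invr_ge0 ?mulr_ge0 ?ler0n ?(ltW l0).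
move: x0 xle; set x := alpha / _; set y := (_)^-1 => x0 xy.
rewrite ler_pdivlMr ?ltr_pwDl //.
have xy2 : x ^+ 2 <= y ^+ 2 by rewrite lerXn2r ?nnegrE // (le_trans x0).
have := mulr_ge0 (sqr_ge0 y) x0.
by rewrite -/x; nra.
Unshelve. all: by end_near. Qed.

Lemma mean_nparts_cvg (R : realType) (alpha lambda : R) :
  0 <= alpha -> alpha < 1 -> 0 < lambda ->
  mean_nparts alpha (lambda * n%:R) n / n%:R @[n --> \oo] --> EP_limit lambda alpha.
Proof.
move=> a0 a1 l0; rewrite /EP_limit; case: eqP => [->|/eqP a_neq0].
  have h : lambda * (\sum_(i < n) (lambda * n%:R + i%:R)^-1) @[n --> \oo]
      --> lambda * ln (1 + lambda^-1).
    by apply: cvgM; [exact: cvg_cst|exact: harmonic_window_cvg].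
  apply: cvg_trans h; apply: near_eq_cvg; near=> n.
  have n0 : n%:R != 0 :> R by rewrite pnatr_eq0 -lt0n; near: n; exact: nbhs_infty_gt.
  by rewrite mean_nparts_alpha0; field.
have {a_neq0} a0 : 0 < alpha by rewrite lt_neqAle eq_sym a_neq0.
have h : lambda / alpha * (expR (\sum_(i < n) ln (1 + alpha / (lambda * n%:R + i%:R))) - 1)
   @[n --> \oo] --> lambda / alpha * ((1 + lambda^-1) `^ alpha - 1).
  apply: cvgM; first exact: cvg_cst.
  apply: cvgB; last exact: cvg_cst.
  rewrite /powR gt_eqF ?addr_gt0 ?invr_gt0 //.
  apply: (cvg_comp _ expR (log_product_cvg a0 a1 l0)); exact: continuous_expR.
apply: cvg_trans h; apply: near_eq_cvg; near=> n.
have n0 : 0 < n%:R :> R by rewrite ltr0n; near: n; exact: nbhs_infty_gt.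
rewrite mean_nparts_expR ?mulr_gt0 //; set E := expR _; field.
by rewrite !gt_eqF.
Unshelve. all: by end_near. Qed.

(** * Almost sure convergence *)

Lemma measurable_fun_nat d (T : measurableType d) (f : nat -> T) :
  measurable_fun setT f.
Proof. by []. Qed.

Lemma integral_nat_RV d (T : measurableType d) (R : realType)
    (P : probability T R) (X : {RV P >-> nat}) (f : nat -> R) :
  (forall k, 0 <= f k) ->
  (\int[P]_w (f (X w))%:E = \sum_(0 <= k <oo) (f k)%:E * distribution P X [set k])%E.
Proof.
move=> f0.
rewrite -[LHS](@ge0_integral_distribution _ _ _ _ _ _ X (fun k => (f k)%:E)) //.
have -> : [set: nat] = \bigcup_k [set k] by apply/seteqP; split=> // k _; exists k.
rewrite ge0_integral_bigcup //.
- apply: eq_eseriesr => k _.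
  rewrite (eq_integral (cst (f k)%:E)) ?integral_cst // => j; rewrite inE => -> //.
- by move=> k _; rewrite lee_fin.
- by move=> i j _ _ [k [-> ->]].
Qed.

(** By monotone convergence the sum of the [f n] is integrable, hence finite almost
    everywhere, and the terms of a convergent series tend to 0. *)
Lemma ae_cvg0_summable_integral d (T : measurableType d) (R : realType)
    (mu : {measure set T -> \bar R}) (f : nat -> T -> R) :
  (forall n, measurable_fun setT (f n)) -> (forall n x, 0 <= f n x) ->
  (\sum_(0 <= n <oo) \int[mu]_x (f n x)%:E < +oo)%E ->
  {ae mu, forall x, f n x @[n --> \oo] --> 0}.
Proof.
move=> mf f0 fin.
have f0E n x : (0 <= (f n x)%:E)%E by rewrite lee_fin.
have mfE n : measurable_fun setT (EFin \o f n) by exact/measurable_EFinP.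
have S0 x : (0 <= \sum_(0 <= n <oo) (f n x)%:E)%E by exact: nneseries_ge0.
have intS : mu.-integrable setT (fun x => \sum_(0 <= n <oo) (f n x)%:E)%E.
  apply/integrableP; split.
    by apply: ge0_emeasurable_sum => // n _; exact: mfE.
  under eq_integral do rewrite gee0_abs //.
  by rewrite integral_nneseries.
have := integrable_ae measurableT intS.
apply: filterS => x /(_ I) finx.
apply: cvg_series_cvg_0; apply: nnseries_is_cvg => //.
by rewrite ltey_eq finx.
Qed.

(** 1 / (n + 1) ^ 2 is dominated by twice the telescoping difference
    1 / (n + 1) - 1 / (n + 2). *)
Lemma summable_inv_sq (R : realType) (C : R) : 0 <= C ->
  (\sum_(0 <= n <oo) (C * n.+1%:R^-1 ^+ 2)%:E < +oo)%E.
Proof.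
move=> C0; pose f n : R := - (2 * C) * n.+1%:R^-1.
have cf : f n @[n --> \oo] --> 0.
  by rewrite -[0](mulr0 (- (2 * C))); apply: cvgM; [exact: cvg_cst|exact: cvg_harmonic].
have step n : C * n.+1%:R^-1 ^+ 2 <= f n.+1 - f n.
  have n0 : (0 : R) < n.+1%:R by rewrite ltr0n.
  have n1 : (0 : R) < n.+2%:R by rewrite ltr0n.
  have -> : f n.+1 - f n = C * (2 * (n.+1%:R^-1 * n.+2%:R^-1)).
    rewrite /f -(natr1 n.+1) in n1 *.
    by move: n0 n1; set x := n.+1%:R => n0 n1; field; rewrite !gt_eqF.
  rewrite ler_wpM2l // expr2 mulrCA ler_wpM2l ?invr_ge0 ?(ltW n0) //.
  rewrite ler_pdivlMr // mulrC ler_pdivrMr // -(natr1 n.+1).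
  have : (1 : R) <= n.+1%:R by rewrite ler1n.
  by lra.
have homo_f : {homo f : x y / (x <= y)%N >-> x <= y}.
  apply/nondecreasing_seqP => n; rewrite -subr_ge0; apply: le_trans (step n).
  by rewrite mulr_ge0 ?sqr_ge0.
have limf : limn (EFin \o f) = 0%:E.
  by rewrite EFin_lim ?(cvg_lim _ cf) //; apply/cvg_ex; exists 0.
apply: (@le_lt_trans _ _ (\sum_(0 <= n <oo) ((f n.+1)%:E - (f n)%:E))%E).
  apply: lee_nneseries => n; first by rewrite lee_fin mulr_ge0 ?sqr_ge0.
  by rewrite -EFinB lee_fin.
by rewrite nondecreasing_telescope_sumey // limf // -EFinB ltry.
Qed.

(** The fourth-moment bound stays quadratic along theta = lambda n: the growth factor
    accumulated over n steps remains bounded. *)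
Lemma growth_bound (R : realType) (lambda : R) n : 0 < lambda -> (0 < n)%N ->
  (1 + (lambda * n%:R)^-1) ^+ (4 * n) <= expR (4 / lambda).
Proof.
move=> l0 n0; have n0R : (0 : R) < n%:R by rewrite ltr0n.
have -> : 4 / lambda = (4 * n)%:R * (lambda * n%:R)^-1.
  by rewrite natrM; field; rewrite !gt_eqF.
rewrite expRM_natl lerXn2r ?nnegrE ?expR_ge0 ?expR_ge1Dx //.
by rewrite addr_ge0 // invr_ge0 mulr_ge0 ?ltW.
Qed.

Theorem theorem1 (R : realType) (d : measure_display) (T : measurableType d)
    (P : probability T R) (lambda alpha : R) (K : nat -> {RV P >-> nat})
    (hlambda : 0 < lambda) (halpha0 : 0 <= alpha) (halpha1 : alpha < 1)
    (hK : forall n : nat, (0 < n)%N -> forall k : nat,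
       distribution P (K n) [set k] = (EP_nparts alpha (lambda * n%:R) n k)%:E) :
  {ae P, forall w : T,
     (fun n : nat => (K n w)%:R / n%:R : R) @ \oo --> EP_limit lambda alpha}.
Proof.
pose theta n : R := lambda * n%:R.
pose D n k : R := k%:R - mean_nparts alpha (theta n) n.
(* The index is shifted by one because the law of K 0 is unspecified. *)
pose f n w := (D n.+1 (K n.+1 w) / n.+1%:R) ^+ 4.
have f0 n w : 0 <= f n w by rewrite /f (exprM _ 2 2) sqr_ge0.
have mf n : measurable_fun setT (f n).
  exact: (measurableT_comp (@measurable_fun_nat _ _ (fun k => (D n.+1 k / n.+1%:R) ^+ 4))).
have EK n g : (0 < n)%N -> (forall k, 0 <= g k) ->
    (\int[P]_w (g (K n w))%:E = (EP_mean alpha (theta n) n g)%:E)%E.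
  move=> n0 g0; rewrite integral_nat_RV //.
  under eq_eseriesr do rewrite hK // -EFinM.
  rewrite (nneseries_split 0 n.+1); last first.
    move=> k _; rewrite lee_fin mulr_ge0 ?EP_nparts_ge0 ?mulr_gt0 ?ltr0n //.
  rewrite eseries0 ?adde0; last by move=> k nk _; rewrite EP_nparts_gt ?mulr0.
  by rewrite sumEFin big_mkord.
have Ef n : (\int[P]_w (f n w)%:E <= (4 * expR (4 / lambda) * n.+1%:R^-1 ^+ 2)%:E)%E.
  rewrite (EK n.+1 (fun k => (D n.+1 k / n.+1%:R) ^+ 4)) //; last first.
    by move=> k; rewrite (exprM _ 2 2) sqr_ge0.
  have n0 : (0 : R) < n.+1%:R by rewrite ltr0n.
  have t0 : 0 < theta n.+1 by rewrite mulr_gt0.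
  have -> : (fun k => (D n.+1 k / n.+1%:R) ^+ 4) = (fun k => n.+1%:R^-1 ^+ 4 * D n.+1 k ^+ 4).
    by apply/funext => k; rewrite exprMn mulrC.
  rewrite EP_meanZ lee_fin.
  apply: (@le_trans _ _ (n.+1%:R^-1 ^+ 4 * (4 * n.+1%:R ^+ 2 * expR (4 / lambda)))).
    rewrite ler_wpM2l ?exprn_ge0 ?invr_ge0 //.
    apply: le_trans (EP_fourth_moment halpha0 halpha1 t0 n.+1) _.
    by rewrite ler_wpM2l ?growth_bound // mulr_ge0 ?sqr_ge0.
  rewrite le_eqVlt; apply/orP; left; apply/eqP.
  by move: n0; set x := n.+1%:R => n0; field; rewrite gt_eqF.
have sumf : (\sum_(0 <= n <oo) \int[P]_w (f n w)%:E < +oo)%E.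
  apply: le_lt_trans (summable_inv_sq (C := 4 * expR (4 / lambda)) _); last first.
    by rewrite mulr_ge0 ?expR_ge0.
  apply: lee_nneseries => [n _ _|n _]; last exact: Ef.
  by apply: integral_ge0 => w _; rewrite lee_fin.
have := ae_cvg0_summable_integral mf f0 sumf.
apply: filterS => w fw.
have cD : D n.+1 (K n.+1 w) / n.+1%:R @[n --> \oo] --> 0.
  apply/cvgr0Pnorm_lt => e e0.
  have e4 : 0 < e ^+ 4 by rewrite exprn_gt0.
  move/cvgr0Pnorm_lt : fw => /(_ _ e4); apply: filterS => n.
  by rewrite /f normrX ltr_pXn2r ?nnegrE ?(ltW e0).
have -> : EP_limit lambda alpha = 0 + EP_limit lambda alpha by rewrite add0r.
have cm := mean_nparts_cvg halpha0 halpha1 hlambda.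
rewrite -cvg_shiftS in cm; rewrite -cvg_shiftS.
apply: cvg_trans (cvgD cD cm); apply: near_eq_cvg; apply: nearW => n.
by rewrite fctE -mulrDl subrK.
Qed.
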